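(* Let $L>0$ and $T>0$ be finite. Let $\Psi_1^{(1)},\Psi_2^{(1)}$ (defined for $x\in[-L,0)$, $t\in(0,T]$) and $\Psi_1^{(2)},\Psi_2^{(2)}$ (defined for $x\in(0,L]$, $t\in(0,T]$) solve the interface problem for the massless Dirac equation on the two finite intervals, that is: (i) for $j=1$ (with $x\in[-L,0)$) and $j=2$ (with $x\in(0,L]$), and all $t\in(0,T]$, $$i\,\partial_t\Psi_1^{(j)}(x,t)=-i\,\partial_x\Psi_1^{(j)}(x,t),\qquad i\,\partial_t\Psi_2^{(j)}(x,t)=i\,\partial_x\Psi_2^{(j)}(x,t);$$ (ii) for $l=1,2$: $\Psi_l^{(1)}(x,0)=\Psi_{l,0}^{(1)}(x)$ for $x\in[-L,0)$ and $\Psi_l^{(2)}(x,0)=\Psi_{l,0}^{(2)}(x)$ for $x\in(0,L]$, where $\Psi_{l,0}^{(1)},\Psi_{l,0}^{(2)}$ are given initial data; (iii) for $l=1,2$ and all $t\in(0,T]$: $\Psi_l^{(1)}(0,t)=\Psi_l^{(2)}(0,t)$; (iv) for $l=1,2$ and all $t\in(0,T]$: $\Psi_l^{(1)}(-L,t)=\alpha_l^{(1)}(t)$ and $\Psi_l^{(2)}(L,t)=\alpha_l^{(2)}(t)$, where $\alpha_l^{(1)},\alpha_l^{(2)}$ are the boundary data. Then, for $x\in[-L,0)$ and $t\in(0,T]$, $$\Psi_1^{(1)}(x,t)=\begin{cases}\Psi_{1,0}^{(1)}(x-t), & x-t\ge -L,\\ \Psi_1^{(1)}(-L,\,t-x-L),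 & x-t<-L,\end{cases}\qquad \Psi_2^{(1)}(x,t)=\begin{cases}\Psi_{2,0}^{(1)}(x+t), & -x\ge t,\\ \Psi_2^{(1)}(0,x+t), & -x<t,\end{cases}$$ and, for $x\in(0,L]$ and $t\in(0,T]$, $$\Psi_1^{(2)}(x,t)=\begin{cases}\Psi_{1,0}^{(2)}(x-t), & x\ge t,\\ \Psi_1^{(2)}(0,t-x), & x<t,\end{cases}\qquad \Psi_2^{(2)}(x,t)=\begin{cases}\Psi_{2,0}^{(2)}(x+t), & x+t\le L,\\ \Psi_2^{(2)}(L,\,x+t-L), & x+t>L.\end{cases}$$
   Context: All functions are complex-valued. The superscript $(1)$ refers to the left interval $[-L,0]$ and the superscript $(2)$ to the right interval $[0,L]$. Solutions are understood classically: each $\Psi_l^{(j)}$ is continuously differentiable on its domain (one-sided derivatives at $x=\pm L$ and $t=T$) and extends continuously to the closed rectangle; $\Psi_l^{(j)}(0,t)$ denotes the value of this extension at the interface $x=0$, and $\Psi_l^{(j)}(x,0)$ its value at $t=0$. All boundary, interface and initial data are assumed compatible where they meet: $\Psi_{l,0}^{(j)}(0)$ is the limit of $\Psi_{l,0}^{(j)}(x)$ as $x\to 0$ within the corresponding interval and equals $\Psi_l^{(j)}(0,0)$; $\Psi_{l,0}^{(1)}(-L)=\alpha_l^{(1)}(0)$ and $\Psi_{l,0}^{(2)}(L)=\alpha_l^{(2)}(0)$, with $\alpha_l^{(j)}(0)$ understood as the limit as $t\to0^+$. *)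

(* Defs.v *)
From Stdlib Require Import Reals.
From Coquelicot Require Import Coquelicot.
Open Scope R_scope.

(* The superscripts (1), (2) are [Left], [Right]; the subscripts 1, 2 are
   [Comp1], [Comp2]. *)
Inductive side := Left | Right.
Inductive component := Comp1 | Comp2.

Definition interval (L : R) (j : side) (x : R) : Prop :=
  match j with
  | Left => -L <= x < 0
  | Right => 0 < x <= L
  end.

Definition closed_interval (L : R) (j : side) (x : R) : Prop :=
  match j with
  | Left => -L <= x <= 0
  | Right => 0 <= x <= L
  end.

Definition outer_end (L : R) (j : side) : R :=
  match j with
  | Left => -L
  | Right => L
  end.

Definition solution_domain (L T : R) (j : side) (p : R * R) : Prop :=
  interval L j (fst p) /\ 0 < snd p <= T.

Definition closed_rectangle (L T : R) (j : side) (p : R * R) : Prop :=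
  closed_interval L j (fst p) /\ 0 <= snd p <= T.

(* [is_derive] with [locally x] replaced by [within D (locally x)]: the usual
   derivative in the interior of [D], a one-sided one at an endpoint of [D]
   that belongs to [D]. *)
Definition is_derive_within (D : R -> Prop) (f : R -> C) (x : R) (d : C) : Prop :=
  filterdiff (K := R_AbsRing) (U := AbsRing_NormedModule R_AbsRing) (V := C_R_NormedModule)
    f (within D (locally x)) (fun y : R => scal y (d : C_R_NormedModule)).

Definition is_dx (D : R * R -> Prop) (f : R * R -> C) (p : R * R) (d : C) : Prop :=
  is_derive_within (fun x => D (x, snd p)) (fun x => f (x, snd p)) (fst p) d.

Definition is_dt (D : R * R -> Prop) (f : R * R -> C) (p : R * R) (d : C) : Prop :=
  is_derive_within (fun t => D (fst p, t)) (fun t => f (fst p, t)) (snd p) d.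

Definition C1_on (D : R * R -> Prop) (f : R * R -> C) : Prop :=
  exists fx ft : R * R -> C,
    (forall p, D p -> is_dx D f p (fx p) /\ is_dt D f p (ft p)) /\
    continuous_on D fx /\ continuous_on D ft.

(* A solution is represented by its continuous extension to the closed
   rectangle, so its values at x = 0 and at t = 0 are those of the extension;
   its values outside the closed rectangle are irrelevant. *)
Definition classical_regularity (L T : R) (j : side) (f : R * R -> C) : Prop :=
  C1_on (solution_domain L T j) f /\ continuous_on (closed_rectangle L T j) f.

Definition dirac_equation (l : component) (D : R * R -> Prop)
    (f : R * R -> C) (p : R * R) : Prop :=
  exists ft fx : C,
    is_dt D f p ft /\ is_dx D f p fx /\
    match l with
    | Comp1 => (Ci * ft = - Ci * fx)%C
    | Comp2 => (Ci * ft = Ci * fx)%C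
    end.

(* Main.v *)
Require Import Defs.
From Stdlib Require Import Reals Lra.
From Coquelicot Require Import Coquelicot.
Open Scope R_scope.

(** Each component solves a scalar transport equation: multiplying the Dirac
    equation by [-i] gives [ft = - c * fx] with speed [c = 1] for [Comp1] and
    [c = -1] for [Comp2].  Hence the function is constant along every
    characteristic line [x - c * t = const], as long as the line stays in the
    closed rectangle ([constant_along_characteristic]).  Each of the eight
    formulas compares the two ends of one characteristic segment: the point
    [(x, t)] and the point where the characteristic through it enters the
    rectangle, either through the bottom [t = 0] or through a side.

    The equation holds only on a domain that misses two edges of the rectangle,
    but a characteristic is strictly monotone in both coordinates, so that all
    of the segment except its ends lies in the open rectangle.  There the
    one-sided derivatives are ordinary ones and the chain rule applies; at
    the ends continuity suffices for the mean value theorem.  As the latter is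
    about real functions, it is applied to the real and the imaginary part. *)

(** * Differentiation along a characteristic *)

Lemma continuous_pair {T U V : UniformSpace} (f : T -> U) (g : T -> V) (x : T) :
  continuous f x -> continuous g x -> continuous (fun y => (f y, g y)) x.
Proof.
intros Hf Hg P [eps HP].
unfold filtermap; apply (filter_imp (fun y => ball (f x) eps (f y) /\ ball (g x) eps (g y))).
- intros y Hy; apply HP; exact Hy.
- apply filter_and; [apply Hf | apply Hg]; apply locally_ball.
Qed.

Lemma is_derive_within_interior (D : R -> Prop) (f : R -> C) (x : R) (d : C) :
  locally x D -> is_derive_within D f x d ->
  is_derive (V := C_R_NormedModule) f x d.
Proof.
intros HD [Hlin Hdom]; split; [exact Hlin |].
intros y Hy.
assert (Hy' : is_filter_lim (within D (locally x)) y).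
{ intros P HP; unfold within; generalize (Hy P HP).
  apply filter_imp; intros z Hz _; exact Hz. }
intros eps; generalize (filter_and _ _ HD (Hdom y Hy' eps)).
apply filter_imp; intros z [Dz Hz]; exact (Hz Dz).
Qed.

Lemma is_derive_linear (phi : C -> R) (f : R -> C) (x : R) (d : C) :
  is_linear (U := C_R_NormedModule) (V := R_NormedModule) phi ->
  is_derive (V := C_R_NormedModule) f x d ->
  is_derive (fun y => phi (f y)) x (phi d).
Proof.
intros Hphi Hf; unfold is_derive.
apply (filterdiff_ext_lin (U := R_NormedModule) _
  (fun y : R => phi (scal y (d : C_R_NormedModule)))).
- apply (filterdiff_comp' (V := C_R_NormedModule) f phi); [exact Hf |].
  now apply filterdiff_linear.
- intros y; exact (linear_scal _ Hphi y d).
Qed.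

(** Continuity of one partial derivative, next to mere existence of the other at
    the point, makes [u] differentiable there, so that the chain rule gives
    [c * ux + ut = 0]. *)
Lemma derive_along_characteristic (u ux : R * R -> R) (c x t : R) :
  locally (x, t) (fun p => is_derive (fun z => u (z, snd p)) (fst p) (ux p)) ->
  continuous ux (x, t) ->
  is_derive (fun s => u (x, s)) t (- (c * ux (x, t))) ->
  is_derive (fun s => u (x + c * (s - t), s)) t 0.
Proof.
intros Hx Hc Ht.
assert (Hd := is_derive_filterdiff (fun a b => u (a, b)) x t
                (fun a b => ux (a, b)) (- (c * ux (x, t)))).
unfold is_derive.
apply (filterdiff_ext_lin (U := R_NormedModule) _
  (fun y : R => plus (scal (scal y c) (ux (x, t))) (scal y (- (c * ux (x, t)))))).
- apply (filterdiff_comp'_2 (fun s => x + c * (s - t)) (fun s => s)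
    (fun a b => u (a, b)) t (fun y => scal y c) (fun y => y)
    (fun a b => plus (scal a (ux (x, t))) (scal b (- (c * ux (x, t)))))).
  + change (is_derive (fun s => x + c * (s - t)) t c).
    auto_derive; [exact I | ring].
  + apply filterdiff_id.
  + replace (x + c * (t - t)) with x by ring.
    apply Hd.
    * revert Hx; apply filter_imp; intros [a b]; exact (fun H => H).
    * exact Ht.
    * apply (continuous_ext ux); [intros [a b]; reflexivity | exact Hc].
- intros y; unfold plus, scal; simpl; unfold mult; simpl; ring.
Qed.

(** * Constancy on segments with end points on the boundary *)

Definition clamp (a b s : R) : R := Rmax a (Rmin b s).

Lemma clamp_bounds (a b s : R) : a <= b -> a <= clamp a b s <= b.
Proof.
intros Hab; unfold clamp; split; [apply Rmax_l |].
apply Rmax_lub; [exact Hab | apply Rmin_l].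
Qed.

Lemma clamp_id (a b s : R) : a <= s <= b -> clamp a b s = s.
Proof.
intros [Has Hsb]; unfold clamp.
rewrite Rmin_right by exact Hsb; apply Rmax_right; exact Has.
Qed.

Lemma continuous_clamp (a b s : R) : continuous (clamp a b) s.
Proof.
apply (continuous_ext (fun y => (a + (b + y - Rabs (b - y)) / 2
   + Rabs (a - (b + y - Rabs (b - y)) / 2)) / 2)).
- intros y; unfold clamp, Rmax, Rmin.
  repeat (destruct Rle_dec); unfold Rabs; repeat (destruct Rcase_abs); lra.
- apply continuity_pt_filterlim; unfold Rdiv; reg.
Qed.

(** Clamping the argument turns continuity relative to the segment, which is
    all that is known at its ends, into two-sided continuity, as required by
    the mean value theorem. *)
Lemma constant_of_derive_zero (g : R -> R) (a b : R) :
  a <= b ->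
  (forall s, continuous (fun y => g (clamp a b y)) s) ->
  (forall s, a < s < b -> is_derive g s 0) ->
  g a = g b.
Proof.
intros Hab Hc Hd.
destruct (MVT_gen (fun y => g (clamp a b y)) a b (fun _ => 0)) as [s [_ Hs]].
- intros s; rewrite Rmin_left, Rmax_right by exact Hab; intros Hs.
  apply (is_derive_ext_loc g); [| exact (Hd s Hs)].
  assert (Hl : locally s (fun y => a < y < b)).
  { apply (open_and _ _ (open_gt a) (open_lt b)); exact Hs. }
  revert Hl; apply filter_imp; intros y Hy; rewrite clamp_id; [reflexivity | lra].
- intros s _; apply continuity_pt_filterlim; exact (Hc s).
- rewrite !clamp_id in Hs by lra; lra.
Qed.

(** * Transport in the rectangle *)

Definition open_rectangle (L T : R) (j : side) (p : R * R) : Prop :=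
  match j with
  | Left => -L < fst p < 0
  | Right => 0 < fst p < L
  end /\ 0 < snd p < T.

Lemma open_rectangle_solution_domain (L T : R) (j : side) (p : R * R) :
  open_rectangle L T j p -> solution_domain L T j p.
Proof. unfold open_rectangle, solution_domain; destruct j; simpl; lra. Qed.

Lemma open_open_rectangle (L T : R) (j : side) : open (open_rectangle L T j).
Proof.
assert (Hf : forall a b, open (fun p : R * R => a < fst p < b)).
{ intros a b; apply (open_comp (@fst R R) (fun x => a < x < b)).
  - intros p _; apply continuous_fst.
  - exact (open_and _ _ (open_gt a) (open_lt b)). }
assert (Hs : open (fun p : R * R => 0 < snd p < T)).
{ apply (open_comp (@snd R R) (fun x => 0 < x < T)).
  - intros p _; apply continuous_snd.
  - exact (open_and _ _ (open_gt 0) (open_lt T)). }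
unfold open_rectangle; destruct j; apply open_and; auto.
Qed.

Definition speed (l : component) : R :=
  match l with
  | Comp1 => 1
  | Comp2 => -1
  end.

Lemma dirac_transport (l : component) (D : R * R -> Prop)
    (f : R * R -> C) (p : R * R) :
  dirac_equation l D f p ->
  exists fx : C, is_dx D f p fx /\
    is_dt D f p (scal (- speed l) (fx : C_R_NormedModule)).
Proof.
intros (ft & fx & Ht & Hx & Heq); exists fx; split; [exact Hx |].
replace (scal (- speed l) (fx : C_R_NormedModule)) with ft; [exact Ht |].
destruct ft as [a b], fx as [a' b'].
unfold scal; simpl; unfold prod_scal, scal; simpl; unfold mult; simpl.
destruct l; injection Heq; intros H1 H2; apply injective_projections; simpl; lra.
Qed.

Section Transport.

Variables (L T : R) (l : component) (j : side) (f : R * R -> C).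
Hypothesis regular : classical_regularity L T j f.
Hypothesis dirac : forall p, solution_domain L T j p ->
  dirac_equation l (solution_domain L T j) f p.

Lemma interior_dx (p : R * R) (d : C) :
  open_rectangle L T j p -> is_dx (solution_domain L T j) f p d ->
  is_derive (V := C_R_NormedModule) (fun x => f (x, snd p)) (fst p) d.
Proof.
intros Hp; apply is_derive_within_interior.
apply (filter_imp (fun x => open_rectangle L T j (x, snd p))).
- intros x; apply open_rectangle_solution_domain.
- apply (open_comp (fun x => (x, snd p)) (open_rectangle L T j)).
  + intros x _; apply (continuous_pair (U := R_UniformSpace) (V := R_UniformSpace)
      (fun x => x) (fun _ => snd p)).
    * apply continuous_id.
    * apply continuous_const.
  + apply open_open_rectangle.
  + destruct p; exact Hp.
Qed.

Lemma interior_dt (p : R * R) (d : C) :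
  open_rectangle L T j p -> is_dt (solution_domain L T j) f p d ->
  is_derive (V := C_R_NormedModule) (fun t => f (fst p, t)) (snd p) d.
Proof.
intros Hp; apply is_derive_within_interior.
apply (filter_imp (fun t => open_rectangle L T j (fst p, t))).
- intros t; apply open_rectangle_solution_domain.
- apply (open_comp (fun t => (fst p, t)) (open_rectangle L T j)).
  + intros t _; apply (continuous_pair (U := R_UniformSpace) (V := R_UniformSpace)
      (fun _ => fst p) (fun t => t)).
    * apply continuous_const.
    * apply continuous_id.
  + apply open_open_rectangle.
  + destruct p; exact Hp.
Qed.

Lemma interior_derive_along_characteristic (phi : C -> R) (x t : R) :
  is_linear (U := C_R_NormedModule) (V := R_NormedModule) phi ->
  open_rectangle L T j (x, t) ->
  is_derive (fun s => phi (f (x + speed l * (s - t), s))) t 0.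
Proof.
intros Hphi Hp.
destruct regular as [(fx & ft & Hd & Hcx & _) _].
apply (derive_along_characteristic (fun p => phi (f p)) (fun p => phi (fx p))).
- generalize (open_open_rectangle L T j _ Hp); apply filter_imp.
  intros q Hq; apply (is_derive_linear phi (fun z => f (z, snd q))); [exact Hphi |].
  apply interior_dx; [exact Hq |].
  apply Hd, open_rectangle_solution_domain; exact Hq.
- apply (continuous_comp (V := C_UniformSpace) fx phi).
  + apply (continuous_continuous_on (solution_domain L T j)); [| exact Hcx].
    generalize (open_open_rectangle L T j _ Hp); apply filter_imp.
    apply open_rectangle_solution_domain.
  + exact (linear_cont _ _ Hphi).
- destruct (dirac_transport _ _ _ _
    (dirac _ (open_rectangle_solution_domain _ _ _ _ Hp))) as (d & Hdx & Hdt).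
  (* The equation provides its own x-derivative; it is the one of [fx]. *)
  assert (E : phi (fx (x, t)) = phi d).
  { transitivity (Derive (fun z => phi (f (z, t))) x).
    - symmetry; apply is_derive_unique.
      apply (is_derive_linear phi (fun z => f (z, t))); [exact Hphi |].
      apply (interior_dx (x, t)); [exact Hp |].
      apply Hd, open_rectangle_solution_domain; exact Hp.
    - apply is_derive_unique.
      apply (is_derive_linear phi (fun z => f (z, t))); [exact Hphi |].
      exact (interior_dx (x, t) _ Hp Hdx). }
  rewrite E.
  replace (- (speed l * phi d)) with (phi (scal (- speed l) (d : C_R_NormedModule))).
  + apply (is_derive_linear phi (fun s => f (x, s))); [exact Hphi |].
    exact (interior_dt (x, t) _ Hp Hdt).
  + rewrite (linear_scal _ Hphi); unfold scal; simpl; unfold mult; simpl; ring.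
Qed.

(** It suffices that the ends lie in the closed rectangle, by its convexity;
    since [speed l] is not zero, the rest of the segment is then in the open
    rectangle. *)
Lemma constant_along_characteristic (x1 t1 x2 t2 : R) :
  closed_rectangle L T j (x1, t1) -> closed_rectangle L T j (x2, t2) ->
  t1 <= t2 -> x2 = x1 + speed l * (t2 - t1) ->
  f (x2, t2) = f (x1, t1).
Proof.
intros H1 H2 Ht Hx.
assert (Hreal : forall phi : C -> R,
  is_linear (U := C_R_NormedModule) (V := R_NormedModule) phi ->
  phi (f (x2, t2)) = phi (f (x1, t1))).
{ intros phi Hphi.
  set (g s := phi (f (x1 + speed l * (s - t1), s))).
  assert (Hg : g t1 = g t2).
  { apply constant_of_derive_zero; [exact Ht | |].
    - intros s; unfold g.
      apply (continuous_comp (V := C_UniformSpace)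
        (fun y => f (x1 + speed l * (clamp t1 t2 y - t1), clamp t1 t2 y)) phi);
        [| exact (linear_cont _ _ Hphi)].
      assert (Hin : forall y, closed_rectangle L T j
        (x1 + speed l * (clamp t1 t2 y - t1), clamp t1 t2 y)).
      { intros y; assert (Hy := clamp_bounds t1 t2 y Ht).
        revert H1 H2; unfold closed_rectangle.
        destruct j, l; simpl in Hx |- *; lra. }
      apply (filterlim_comp _ _ _
        (fun y => (x1 + speed l * (clamp t1 t2 y - t1), clamp t1 t2 y)) f _
        (within (closed_rectangle L T j) (locally
          (x1 + speed l * (clamp t1 t2 s - t1), clamp t1 t2 s)))).
      + assert (Hc : continuous
          (fun y => (x1 + speed l * (clamp t1 t2 y - t1), clamp t1 t2 y)) s).
        { apply (continuous_pair
            (fun y => x1 + speed l * (clamp t1 t2 y - t1)) (clamp t1 t2));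
            [| apply continuous_clamp].
          apply (continuous_comp (clamp t1 t2) (fun y => x1 + speed l * (y - t1))).
          - apply continuous_clamp.
          - apply continuity_pt_filterlim; reg. }
        intros P HP; generalize (Hc _ HP); unfold filtermap; apply filter_imp.
        intros y HPy; exact (HPy (Hin y)).
      + exact (proj2 regular _ (Hin s)).
    - intros s Hs.
      apply (is_derive_ext (fun y => phi (f
        ((x1 + speed l * (s - t1)) + speed l * (y - s), y)))).
      + intros y; unfold g; do 3 f_equal; ring.
      + apply interior_derive_along_characteristic; [exact Hphi |].
        revert H1 H2; unfold closed_rectangle, open_rectangle.
        destruct j, l; simpl in Hx |- *; lra. }
  unfold g in Hg; rewrite <- Hx in Hg.
  replace (x1 + speed l * (t1 - t1)) with x1 in Hg by ring.
  now symmetry. }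
apply injective_projections; apply Hreal; [apply is_linear_fst | apply is_linear_snd].
Qed.

End Transport.

(** * The solution formulas *)

Theorem proposition3 :
  forall (L T : R)
    (Psi : component -> side -> R * R -> C)
    (Psi0 : component -> side -> R -> C)
    (alpha : component -> side -> R -> C),
  0 < L -> 0 < T ->
  (* classical solutions *)
  (forall l j, classical_regularity L T j (Psi l j)) ->
  (* (i) *)
  (forall l j p, solution_domain L T j p ->
     dirac_equation l (solution_domain L T j) (Psi l j) p) ->
  (* (ii) *)
  (forall l j x, interval L j x -> Psi l j (x, 0) = Psi0 l j x) ->
  (* (iii) *)
  (forall l t, 0 < t <= T -> Psi l Left (0, t) = Psi l Right (0, t)) ->
  (* (iv) *)
  (forall l j t, 0 < t <= T -> Psi l j (outer_end L j, t) = alpha l j t) ->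
  (* compatibility at the interface *)
  (forall l j,
     filterlim (Psi0 l j) (within (interval L j) (locally 0))
       (locally (Psi0 l j 0))) ->
  (forall l j, Psi0 l j 0 = Psi l j (0, 0)) ->
  (* compatibility at the outer ends *)
  (forall l j, filterlim (alpha l j) (at_right 0) (locally (alpha l j 0))) ->
  (forall l j, Psi0 l j (outer_end L j) = alpha l j 0) ->
  (forall x t, -L <= x < 0 -> 0 < t <= T ->
     (x - t >= -L -> Psi Comp1 Left (x, t) = Psi0 Comp1 Left (x - t)) /\
     (x - t < -L -> Psi Comp1 Left (x, t) = Psi Comp1 Left (-L, t - x - L)) /\
     (-x >= t -> Psi Comp2 Left (x, t) = Psi0 Comp2 Left (x + t)) /\
     (-x < t -> Psi Comp2 Left (x, t) = Psi Comp2 Left (0, x + t)))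
  /\
  (forall x t, 0 < x <= L -> 0 < t <= T ->
     (x >= t -> Psi Comp1 Right (x, t) = Psi0 Comp1 Right (x - t)) /\
     (x < t -> Psi Comp1 Right (x, t) = Psi Comp1 Right (0, t - x)) /\
     (x + t <= L -> Psi Comp2 Right (x, t) = Psi0 Comp2 Right (x + t)) /\
     (x + t > L -> Psi Comp2 Right (x, t) = Psi Comp2 Right (L, x + t - L))).
Proof.
intros L T Psi Psi0 alpha HL HT Hreg Hdirac Hinit _ _ _ Hzero _ _.
assert (Htrans : forall l j x1 t1 x t,
  closed_rectangle L T j (x1, t1) -> closed_rectangle L T j (x, t) ->
  t1 <= t -> x = x1 + speed l * (t - t1) ->
  Psi l j (x, t) = Psi l j (x1, t1)).
{ intros l j; apply constant_along_characteristic; auto. }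
(* The initial condition leaves out the interface, where the compatibility of
   the data takes its place. *)
assert (Hinit' : forall l j x, closed_interval L j x ->
  Psi l j (x, 0) = Psi0 l j x).
{ intros l j x Hx; destruct (Req_dec x 0) as [-> | Hx0].
  - symmetry; apply Hzero.
  - apply Hinit; destruct j; simpl in Hx |- *; lra. }
split; intros x t Hx Ht; repeat split; intros H;
  try (rewrite <- Hinit' by (simpl; lra));
  apply Htrans; unfold closed_rectangle; simpl; lra.
Qed.
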